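(* Let $x$ be a bi-infinite recurrent word over a finite alphabet, and let $\eta\colon \mathbb{N} \to [0,\infty)$ be an arbitrary non-decreasing function such that $\lim_{n\to\infty} \eta(n) = +\infty$. Then $x$ has a string attractor $\Gamma$ such that $\#(\Gamma \cap [-n,n]) \le \eta(n)$ for all $n \in \mathbb{N}$.
   Context: $[j,k]$ denotes the set of integers $\{j,\dots,k\}$ and $x_{[j,k]} = x_j\cdots x_k$. A bi-infinite word $x$ is recurrent if each of its factors (finite words occurring in $x$) has infinitely many occurrences in $x$. A set $\Gamma \subseteq \mathbb{Z}$ is a string attractor of $x$ if for every non-empty factor $w$ of $x$ there is $i \in \mathbb{Z}$ with $x_{[i,i+|w|-1]} = w$ and $[i,i+|w|-1]\cap\Gamma \ne \emptyset$. *)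

(* Defs.v *)
From HB Require Import structures.
From mathcomp Require Import all_boot all_order all_algebra.
From mathcomp Require Import finmap.
From mathcomp Require Import all_classical all_reals all_analysis.

Set Implicit Arguments.
Unset Strict Implicit.
Unset Printing Implicit Defensive.

Import Order.TTheory GRing.Theory Num.Theory.
Import numFieldNormedType.Exports.

Local Open Scope classical_set_scope.
Local Open Scope ring_scope.

(* x_j ... x_k; the empty word as soon as k < j. *)
Definition subword (A : Type) (x : int -> A) (j k : int) : seq A :=
  [seq x (j + m%:Z) | m <- iota 0 (absz (Num.max 0 (k - j + 1)))].

Definition occurs_at (A : Type) (x : int -> A) (w : seq A) (i : int) : Prop :=
  subword x i (i + (size w)%:Z - 1) = w.

Definition factor (A : Type) (x : int -> A) (w : seq A) : Prop :=
  exists i : int, occurs_at x w i.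

(* Distinct occurrences are distinct starting positions; they may all lie on
   one side of the origin. *)
Definition recurrent (A : Type) (x : int -> A) : Prop :=
  forall w : seq A, factor x w -> infinite_set [set i | occurs_at x w i].

Definition string_attractor (A : Type) (x : int -> A) (Gamma : set int) : Prop :=
  forall w : seq A, w <> [::] -> factor x w ->
    exists i : int, occurs_at x w i /\
      [set` `[i, i + (size w)%:Z - 1]] `&` Gamma !=set0.

(* Main.v *)
Require Import Defs.
From HB Require Import structures.
From mathcomp Require Import all_boot all_order all_algebra.
From mathcomp Require Import finmap.
From mathcomp Require Import all_classical all_reals all_analysis.

(** There are only countably many words over a finite alphabet, so the attractor
    can devote one position [p k] to the [k]-th word.  By recurrence each factor
    occurs arbitrarily far from the origin ([infinite_set_int_unbounded]), hence
    the start [p k] of an occurrence of the [k]-th word may be pushed past a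
    radius from which on [eta] is at least [k + 1].  Then [p k] lies in [[-n, n]]
    only if [k + 1 <= eta n], so at most [eta n] indices contribute to that
    window ([card_range_window_le]); and the range of [p] is a string attractor
    since it meets an occurrence of each nonempty factor at its first letter. *)

Set Implicit Arguments.
Unset Strict Implicit.
Unset Printing Implicit Defensive.

Import Order.TTheory GRing.Theory Num.Theory.
Import numFieldNormedType.Exports.

Local Open Scope classical_set_scope.
Local Open Scope ring_scope.

Lemma infinite_set_int_unbounded (D : set int) (N : nat) :
  infinite_set D -> exists2 p : int, D p & (N < `|p|)%N.
Proof.
move=> Dinf; apply: contrapT => bounded; apply: Dinf.
apply: (@sub_finite_set _ _
  ((Posz @` `I_N.+1) `|` ((fun n : nat => - n%:Z) @` `I_N.+1))).
  move=> p Dp; have absp : (`|p| <= N)%N.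
    by rewrite leqNgt; apply/negP => Np; apply: bounded; exists p.
  by case: (intP p) absp => [|n|n] absp;
    [left; exists 0%N | left; exists n.+1 | right; exists n.+1].
by rewrite finite_setU; split; apply: finite_image; exact: finite_II.
Qed.

(** The map [p] need not be injective: what is counted is the set of indices [k]
    with [p k] in the window, all of which are below the integer part of [c]. *)
Lemma card_range_window_le (R : realType) (p : nat -> int) (n : nat) (c : R) :
  0 <= c -> (forall k : nat, (`|p k| <= n)%N -> k.+1%:R <= c) ->
  #|` fset_set (range p `&` [set` `[- n%:Z, n%:Z]])|%:R <= c.
Proof.
move=> c0 pc; set W := _ `&` _; pose m := Num.truncn c.
have Wsub : W `<=` p @` `I_m.
  move=> _ [[k _ <-]]; rewrite /= in_itv /= => /andP[lo hi].
  exists k => //=; rewrite /m truncn_ge_nat //; apply: pc.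
  by rewrite -lez_nat abszE ler_norml lo hi.
have finI : finite_set (p @` `I_m) by apply: finite_image; exact: finite_II.
have finW : finite_set W by exact: sub_finite_set finI.
apply: (@le_trans _ _ m%:R); last by rewrite truncn_le.
rewrite ler_nat -[leqRHS](size_iota 0) -(size_map p).
apply: uniq_leq_size => [|q]; first exact: fset_uniq.
rewrite in_fset_set // inE => /Wsub[k /= km <-].
by apply: map_f; rewrite mem_iota.
Qed.

Theorem proposition52 (R : realType) (A : finType) (x : int -> A)
    (x_rec : recurrent x) (eta : nat -> R)
    (eta_ge0 : forall n : nat, 0 <= eta n)
    (eta_nd : forall m n : nat, (m <= n)%N -> eta m <= eta n)
    (eta_lim : eta n @[n --> \oo] --> +oo) :
  exists Gamma : set int,
    string_attractor x Gamma /\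
    forall n : nat,
      #|` fset_set (Gamma `&` [set` `[- n%:Z, n%:Z]])|%:R <= eta n.
Proof.
have radius k : exists N : nat, forall n, (N <= n)%N -> k.+1%:R <= eta n.
  have /cvgryPge /(_ k.+1%:R) [N _ etaN] := eta_lim.
  by exists N => n Nn; exact: etaN.
have /choice[N etaN] := radius.
have far k : exists p : int, (N k < `|p|)%N /\
    forall w : seq A, choice.unpickle k = Some w -> Defs.factor x w -> occurs_at x w p.
  have [[w [kw fw]]|nofactor] :=
      pselect (exists w : seq A, choice.unpickle k = Some w /\ Defs.factor x w).
    have [p wp Np] := infinite_set_int_unbounded (N k) (x_rec w fw).
    by exists p; split=> // w'; rewrite kw => -[<-].
  (* The index k does not encode a factor, so any distant position will do. *)
  by exists (N k).+1%:Z; split=> // w kw fw; case: nofactor; exists w.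
have /choice[p pP] := far.
exists (range p); split=> [w w0 fw|n].
  exists (p (choice.pickle w)); split; first by apply: (pP _).2 => //; exact: choice.pickleK.
  exists (p (choice.pickle w)); split; last by exists (choice.pickle w).
  rewrite /= in_itv /= lexx /= -addrA lerDl subr_ge0 lez_nat.
  by case: w w0 {fw}.
apply: card_range_window_le => // k kn; apply: etaN.
exact: leq_trans (ltnW (pP k).1) kn.
Qed.
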